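(* Let $p>N=1$ and $\Omega=(a,b)$ a bounded open interval. For each $x\in(a,b)$ one has $$s_p(x)=\left((x-a)^{1-p}+(b-x)^{1-p}\right)^{-1/p}$$ and the function $u_p$ (associated with $x$) is given by $$u_p(y)=\begin{cases}(y-a)(x-a)^{-1}&\text{if } a\leq y\leq x,\\ (b-y)(b-x)^{-1}&\text{if } x\leq y\leq b.\end{cases}$$
   Context: $\|\cdot\|_p$ is the standard norm of $L^p(\Omega)$. Each $v\in W_0^{1,p}(\Omega)$ is identified with its continuous representative on $\overline\Omega$, which vanishes on $\partial\Omega$. For $x\in\Omega$, $s_p(x):=\sup\{|v(x)|/\|\nabla v\|_p: v\in W_0^{1,p}(\Omega)\setminus\{0\}\}$ (here $\nabla v=v'$). For fixed $x\in\Omega$, $u_p\in W_0^{1,p}(\Omega)$ denotes the unique weak solution of $-\Delta_p u=(s_p(x))^{-p}\delta_x$ in $\Omega$, $u=0$ on $\partial\Omega$; that is, the unique $u\in W_0^{1,p}(\Omega)$ with $\int_\Omega|\nabla u|^{p-2}\nabla u\cdot\nabla\phi\,\mathrm{d}y=(s_p(x))^{-p}\phi(x)$ for all $\phi\in W_0^{1,p}(\Omega)$. *)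

(* Defs.v *)
From HB Require Import structures.
From mathcomp Require Import all_boot all_order all_algebra.
From mathcomp Require Import all_classical all_reals all_analysis.
Import Order.TTheory GRing.Theory Num.Theory.
Import numFieldNormedType.Exports.

Set Implicit Arguments.
Unset Strict Implicit.
Unset Printing Implicit Defensive.

Local Open Scope classical_set_scope.
Local Open Scope ring_scope.

(* Functions on a one-dimensional domain [Om] are represented by total
   functions [R -> R]; only their values on [closure Om] matter below. *)

Definition test_function {R : realType} (Om : set R) (phi : R -> R) : Prop :=
  [/\ forall (n : nat) (y : R), derivable (derive1n n phi) y 1,
      compact (closure [set y | phi y != 0]) &
      closure [set y | phi y != 0] `<=` Om].

Definition weak_derivative {R : realType} (Om : set R) (v g : R -> R) : Prop :=
  [/\ locally_integrable Om v, locally_integrable Om g &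
      forall phi : R -> R, test_function Om phi ->
        (\int[lebesgue_measure]_(y in Om) (v y * derive1 phi y)%:E =
         - \int[lebesgue_measure]_(y in Om) (g y * phi y)%:E)%E].

Definition in_Lp {R : realType} (p : R) (Om : set R) (f : R -> R) : Prop :=
  f \_ Om \in Lfun (@lebesgue_measure R) p%:E.

Definition Lp_norm {R : realType} (p : R) (Om : set R) (f : R -> R) : \bar R :=
  'N[@lebesgue_measure R]_(p%:E)[EFin \o (f \_ Om)]%E.

(* [sobolev_W1p p Om v g] : v belongs to W^{1,p}(Om), with weak gradient g
   (which is unique up to a null set). *)
Definition sobolev_W1p {R : realType} (p : R) (Om : set R) (v g : R -> R)
    : Prop :=
  [/\ in_Lp p Om v, in_Lp p Om g & weak_derivative Om v g].

(* [sobolev_W01p p Om v g] : v is the representative, continuous on the closure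
   of Om, of an element of W_0^{1,p}(Om) with weak gradient g.  W_0^{1,p} is the
   closure of the test functions for the norm ||v||_p + ||v'||_p of W^{1,p};
   that v vanishes on the boundary is a consequence and is not imposed. *)
Definition sobolev_W01p {R : realType} (p : R) (Om : set R) (v g : R -> R)
    : Prop :=
  [/\ {within closure Om, continuous v}, sobolev_W1p p Om v g &
      forall e : R, 0 < e -> exists2 phi : R -> R, test_function Om phi &
        (Lp_norm p Om (v \- phi)%R + Lp_norm p Om (g \- derive1 phi)%R < e%:E)%E].

(* As v is continuous, v differs from the zero element of W_0^{1,p}(Om) iff it
   is nonzero somewhere in Om. *)
Definition s_ {R : realType} (p : R) (Om : set R) (x : R) : \bar R :=
  ereal_sup [set r : \bar R | exists v g : R -> R,
    [/\ sobolev_W01p p Om v g, exists2 y, Om y & v y != 0 &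
        r = (`|v x| / fine (Lp_norm p Om g))%:E]].

(* [u] is a weak solution in W_0^{1,p}(Om) of  - Delta_p u = c delta_x.
   For 1 < p < 2, |t|^{p-2} t is read as 0 at t = 0, as usual. *)
Definition weak_p_laplace_dirac {R : realType} (p : R) (Om : set R) (c x : R)
    (u : R -> R) : Prop :=
  exists2 g : R -> R, sobolev_W01p p Om u g &
    forall phi h : R -> R, sobolev_W01p p Om phi h ->
      (\int[lebesgue_measure]_(y in Om) (`|g y| `^ (p - 2) * g y * h y)%:E =
       (c * phi x)%:E)%E.

(* Main.v *)
Require Import Defs.
From HB Require Import structures.
From mathcomp Require Import all_boot all_order all_algebra.
From mathcomp Require Import all_classical all_reals all_analysis.
From mathcomp Require Import measurable_realfun ring lra.
Import Order.TTheory GRing.Theory Num.Theory.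
Import numFieldNormedType.Exports.

(** Density of the test functions gives [v y = \int_a^y h] and [v b = 0] for
   every [v] in W_0^{1,p}(a,b) with weak gradient [h].  Let [g] be the slope of
   the hat function [w] with [w x = 1].  Its flux [|g|^{p-2} g] takes the
   constant values [(x-a)^{1-p}] on [(a,x)] and [-(b-x)^{1-p}] on [(x,b)], hence
   [\int |g|^{p-2} g h = c * v x] with [c = (x-a)^{1-p} + (b-x)^{1-p}]: the hat
   is a weak solution with source [c delta_x].  Since [\int |g|^p = c], Hoelder's
   inequality turns this identity into [|v x| <= c^{-1/p} ||h||_p], with equality
   for the hat.  If [u], with gradient [k], is another solution, testing both
   equations with [u] and [w] gives
   [\int (|k|^{p-2} k - |g|^{p-2} g) (k - g) = 0], and the strict monotonicity of
   [s |-> |s|^{p-2} s] forces [k = g] a.e., so [u = w].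
   The hat belongs to W_0^{1,p} because smoothing its three corners on scale [e]
   changes its gradient by a bounded amount on a set of measure at most [5 e]. *)

Set Implicit Arguments.
Unset Strict Implicit.
Unset Printing Implicit Defensive.

Local Open Scope classical_set_scope.
Local Open Scope ring_scope.

(** * Smooth ramps *)

Section smooth.
Context {R : realType}.
Implicit Types (f g : R -> R) (n : nat).

(** Differentiability [n] times on the whole line, with the derivative given by a witness: the
    closure rules below become inductions that supply an explicit derivative, and [derive1n] appears
    only in [diffnP]. *)
Fixpoint diffn n f : Prop :=
  if n is n'.+1 then
    exists2 df : R -> R, forall y, is_derive y (1:R) f (df y) & diffn n' df
  else True.

Lemma diffnP f :
  (forall n, diffn n f) -> forall n y, derivable (derive1n n f) y 1.
Proof.
move=> fs n; move: (fs n.+1) => {fs}; elim: n f => [|n ih] f.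
  by move=> [df fdf _] y; rewrite derive1n0; case: (fdf y).
move=> [df fdf hdf] y; rewrite derive1Sn.
suff -> : derive1 f = df by exact: ih.
by apply/funext => z; rewrite derive1E; case: (fdf z).
Qed.

Lemma diffnW n f : diffn n.+1 f -> diffn n f.
Proof.
elim: n f => // n ih f [df fdf hdf]; exists df => //.
exact: ih.
Qed.

Lemma diffn_ext n f g : f =1 g -> diffn n f -> diffn n g.
Proof. by move=> /funext ->. Qed.

Lemma diffn_cst n (k : R) : diffn n (fun=> k).
Proof.
elim: n k => // n ih k; exists (fun=> 0) => //.
by move=> y; exact: is_derive_cst.
Qed.

Lemma diffnD n f g : diffn n f -> diffn n g -> diffn n (f \+ g).
Proof.
elim: n f g => // n ih f g [df fdf hdf] [dg gdg hdg].
exists (df \+ dg); last exact: ih.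
by move=> y; exact: is_deriveD.
Qed.

(** Each term of the product rule contains an undifferentiated factor, which is why [diffnW] is
    applied to [f] and [g] before the induction hypothesis. *)
Lemma diffnM n f g : diffn n f -> diffn n g -> diffn n (f \* g).
Proof.
elim: n f g => // n ih f g /[dup] /diffnW hf [df fdf hdf].
move=> /[dup] /diffnW hg [dg gdg hdg].
exists ((f \* dg) \+ (g \* df)); last by apply: diffnD; exact: ih.
by move=> y; exact: is_deriveM.
Qed.

Lemma diffnB n f g : diffn n f -> diffn n g -> diffn n (fun y => f y - g y).
Proof.
move=> hf hg.
have := diffnD hf (diffnM (diffn_cst n (-1)) hg).
by apply: diffn_ext => y /=; rewrite mulN1r.
Qed.

Lemma is_derive_affine (k c y : R) : is_derive y (1:R) (fun y => k * y + c) k.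
Proof.
have := is_deriveD (is_deriveZ k (is_derive_id y (1:R))) (is_derive_cst c y (1:R)).
by rewrite addr0 /GRing.scale /= mulr1.
Qed.

Lemma diffn_affine_id n (k c : R) : diffn n (fun y => k * y + c).
Proof.
case: n => // n; exists (fun=> k); last exact: diffn_cst.
by move=> y; exact: is_derive_affine.
Qed.

Lemma is_derive_comp_affine f (k c y df : R) : is_derive (k * y + c) (1:R) f df ->
  is_derive y (1:R) (fun y => f (k * y + c)) (k * df).
Proof.
move=> fdf; rewrite mulrC.
exact: (@is_derive1_comp _ f (fun y : R => k * y + c) y _ _ fdf (is_derive_affine k c y)).
Qed.

Lemma diffn_affine n f (k c : R) : diffn n f -> diffn n (fun y => f (k * y + c)).
Proof.
elim: n f => // n ih f [df fdf hdf].
exists ((fun=> k) \* (fun y => df (k * y + c))).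
  by move=> y; exact: is_derive_comp_affine.
by apply: diffnM; [exact: diffn_cst|exact: ih].
Qed.

(** As [(1/f)' = - f' (1/f)^2], the derivative involves [1/f] itself only at the lower order, where
    the induction hypothesis applies. *)
Lemma diffnV n f : (forall y, f y != 0) -> diffn n f ->
  diffn n (fun y => (f y)^-1).
Proof.
move=> f0; elim: n => // n ih /[dup] /diffnW hf [df fdf hdf].
exists ((fun=> -1) \* (df \* ((fun y => (f y)^-1) \* (fun y => (f y)^-1)))).
  move=> y; apply: is_derive_eq (is_deriveV (f0 y) (fdf y)) _.
  rewrite /GRing.scale/=; have f0y := f0 y.
  by field.
apply: diffnM; first exact: diffn_cst.
by do 2![apply: diffnM; rewrite ?ih//]; exact: ih.
Qed.

(* Negative powers are included so that the family is closed under
   differentiation; smoothness of [exp (-1/t)] is then an induction. *)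
Definition flat k (t : R) : R :=
  if 0 < t then t ^- k * expR (- t^-1) else 0.

Lemma flat_ge0 k t : 0 <= flat k t.
Proof.
rewrite /flat; case: ifPn => // t0.
by rewrite mulr_ge0 ?expR_ge0// invr_ge0 exprn_ge0// ltW.
Qed.

Lemma flat_gt0 k t : 0 < t -> 0 < flat k t.
Proof.
by move=> t0; rewrite /flat t0 mulr_gt0 ?expR_gt0// invr_gt0 exprn_gt0.
Qed.

Lemma flat_le0 k t : t <= 0 -> flat k t = 0.
Proof. by move=> t0; rewrite /flat ltNge t0. Qed.

(** Comes from [exp s >= s^(k+2) / (k+2)!] at [s = 1/t]. The quadratic decay is what makes the
    difference quotient at [0] tend to [0]. *)
Lemma flat_le k t : 0 < t -> flat k t <= k.+2`!%:R * t ^+ 2.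
Proof.
move=> t0; rewrite /flat t0 expRN.
have ti0 : 0 < t^-1 by rewrite invr_gt0.
have := @expR_ge1Dxn _ t^-1 k.+1 (ltW ti0) => he.
have f0 : 0 < k.+2`!%:R :> R by rewrite ltr0n fact_gt0.
have {he} : t ^- k.+2 / k.+2`!%:R <= expR t^-1.
  by rewrite -exprVn; apply: le_trans he; rewrite lerDr.
rewrite ler_pdivrMr // => he.
rewrite -[leLHS]/(_ / _) ler_pdivrMr ?expR_gt0//.
rewrite mulrAC [_ * expR _]mulrC.
have : t ^- k.+2 * t ^+ 2 = t ^- k.
  by rewrite -addn2 exprD invfM -mulrA mulVf ?mulr1// gt_eqF// exprn_gt0.
move=> <-; rewrite ler_wpM2r// exprn_ge0// ltW//.
Qed.

Lemma is_derive_flat k t :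
  is_derive t (1:R) (flat k) (- k%:R * flat k.+1 t + flat k.+2 t).
Proof.
have [t0|t0|->] := ltgtP t 0.
- rewrite !flat_le0 ?(ltW t0)// mulr0 addr0.
  apply: near_eq_is_derive (is_derive_cst (0:R) t (1:R)).
  near=> y; rewrite flat_le0// ltW//.
  by near: y; exact: lt_nbhsl.
- have tn0 : t != 0 by rewrite gt_eqF.
  have tkn0 : t ^+ k != 0 by rewrite expf_neq0.
  have h1 : is_derive t (1:R) (fun t : R => t ^+ k) (k%:R * t ^+ k.-1).
    have := @is_deriveX _ _ id k t (1:R) _ (is_derive_id t (1:R)).
    by rewrite exprfctE /GRing.scale/= mulr1.
  have h3 := is_deriveN (is_deriveV tn0 (is_derive_id t (1:R))).
  have h4 := is_derive1_comp (is_derive_expR _) h3.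
  have h5 := is_deriveM (@is_deriveV _ (fun t => t ^+ k) _ _ _ tkn0 h1) h4.
  have {}h5 : is_derive t (1:R) (fun t : R => t ^- k * expR (- t^-1))
      (- k%:R * flat k.+1 t + flat k.+2 t).
    apply: is_derive_eq h5 _; rewrite /GRing.scale/= /flat t0 /=.
    (* The derivative of [t ^+ k] contains [k.-1], which truncates at [k = 0]; that case is computed
       apart. *)
    case: k tkn0 {h1} => [|k] tkn0; first by field.
    by rewrite !exprS; field; rewrite tn0 expf_neq0.
  apply: near_eq_is_derive h5.
  near=> y; rewrite /flat ifT//.
  by near: y; exact: lt_nbhsr.
- rewrite !flat_le0// mulr0 addr0.
  have h : h^-1 *: (flat k (h *: 1 + 0) - flat k 0) @[h --> 0^'] --> (0 : R).
    apply/cvgrPdist_le => /= e e0.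
    pose M : R := k.+2`!%:R.
    have M0 : 0 < M by rewrite ltr0n fact_gt0.
    near=> h; rewrite sub0r normrN addr0 (flat_le0 _ (lexx 0)) subr0.
    rewrite /GRing.scale/= mulr1.
    have [h0|h0] := ltP 0 h; last by rewrite flat_le0// mulr0 normr0 ltW.
    rewrite ger0_norm; last by rewrite mulr_ge0// ?flat_ge0// invr_ge0 ltW.
    rewrite ler_pdivrMl//.
    apply: le_trans (flat_le k h0) _.
    rewrite expr2 mulrC -mulrA ler_pM2l// -ler_pdivlMr//.
    apply: ltW; near: h; apply: nbhs_dnbhs; apply: lt_nbhsl.
    by rewrite divr_gt0.
  by apply: DeriveDef; [apply/cvg_ex; exists 0|apply/cvg_lim].
Unshelve. all: by end_near.
Qed.

Lemma diffn_flat n k : diffn n (flat k).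
Proof.
elim: n k => // n ih k.
exists (((fun=> - k%:R) \* flat k.+1) \+ flat k.+2).
  exact: is_derive_flat.
by apply: diffnD => //; apply: diffnM => //; exact: diffn_cst.
Qed.

(** The usual smooth transition from 0 to 1 across [[0, 1]]. The denominator never vanishes because
    [t] and [1 - t] are not both nonpositive. *)
Definition step (t : R) : R := flat 0 t / (flat 0 t + flat 0 (1 - t)).

Lemma step_den_gt0 t : 0 < flat 0 t + flat 0 (1 - t).
Proof.
have [t0|t0] := ltP 0 t.
  by rewrite ltr_pwDl ?flat_gt0 ?flat_ge0.
by rewrite ltr_wpDl ?flat_gt0 ?flat_ge0// subr_gt0 (le_lt_trans t0).
Qed.

Lemma diffn_step n : diffn n step.
Proof.
apply: diffnM; first exact: diffn_flat.
apply: diffnV => [y|]; first by rewrite gt_eqF// step_den_gt0.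
apply: diffnD; first exact: diffn_flat.
apply: diffn_ext (diffn_affine (-1) 1 (diffn_flat n 0)) => y.
by rewrite mulN1r addrC.
Qed.

Lemma step_le0 t : t <= 0 -> step t = 0.
Proof. by move=> t0; rewrite /step flat_le0// mul0r. Qed.

Lemma step_ge1 t : 1 <= t -> step t = 1.
Proof.
move=> t1; rewrite /step (@flat_le0 _ (1 - t)) ?subr_le0// addr0 divff//.
by rewrite gt_eqF// flat_gt0// (lt_le_trans _ t1).
Qed.

Lemma step_ge0 t : 0 <= step t.
Proof. by rewrite divr_ge0 ?flat_ge0// ltW// step_den_gt0. Qed.

Lemma step_le1 t : step t <= 1.
Proof. by rewrite ler_pdivrMr ?step_den_gt0// mul1r lerDl flat_ge0. Qed.

Lemma is_derive_step t : is_derive t (1:R) step (derive1 step t).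
Proof.
have [ds step_ds _] := diffn_step 1.
by have [dst _] := step_ds t; apply: DeriveDef; rewrite ?derive1E.
Qed.

Lemma derive1_step_eq0 t : (t < 0) || (1 < t) -> derive1 step t = 0.
Proof.
have near_cst (k : R) : (\near t, k = step t) -> derive1 step t = 0.
  move=> ht; have [_] := near_eq_is_derive ht (is_derive_cst k t (1:R)).
  by rewrite derive1E.
case/orP => t01; [apply: (near_cst 0)|apply: (near_cst 1)].
  near=> y; rewrite step_le0// ltW//.
  by near: y; exact: lt_nbhsl.
near=> y; rewrite step_ge1// ltW//.
by near: y; exact: lt_nbhsr.
Unshelve. all: by end_near.
Qed.

(** The derivative is continuous, hence bounded on [[0, 1]], and it vanishes outside. The [1 +] in
    the witness only makes the bound positive. *)
Lemma derive1_step_bounded : exists2 M, 0 < M & forall t, `|derive1 step t| <= M.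
Proof.
have [ds step_ds hds] := diffn_step 2.
have dsE : derive1 step = ds.
  by apply/funext => t; rewrite derive1E; case: (step_ds t).
have cds : continuous (fun t => `|ds t|).
  move=> t; apply: continuous_comp; last exact: norm_continuous.
  by have [d /(_ t) [+ _] _] := hds; move/derivable1_diffP/differentiable_continuous.
have [c _ hc] := @EVT_max R _ 0 1 ler01 (continuous_subspaceT cds).
exists (1 + `|ds c|) => [|t]; first by rewrite ltr_pwDl.
have [t01|] := boolP ((t < 0) || (1 < t)).
  by rewrite derive1_step_eq0// normr0 addr_ge0.
rewrite negb_or -!leNgt => t01.
by rewrite dsE ler_wpDl//; apply: hc; rewrite in_itv.
Qed.

Record is_ramp (M c e : R) (r dr : R -> R) : Prop := IsRamp {
  ramp_diffn : forall n, diffn n r;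
  is_derive_ramp : forall y, is_derive y (1:R) r (dr y);
  ramp_itv01 : forall y, 0 <= r y <= 1;
  ramp_eq0 : forall y, y <= c -> r y = 0;
  ramp_eq1 : forall y, c + e <= y -> r y = 1;
  ramp_slope_le : forall y, `|dr y| <= M / e;
  ramp_slope_neq0 : forall y, dr y != 0 -> c <= y <= c + e }.

(** A ramp is [step] composed with [y |-> (y - c) / e]. The order of the quantifiers matters: [M] is
    fixed before [c] and [e], so the bounds obtained from it are uniform in the smoothing scale. *)
Lemma ramp_ex : exists2 M, 0 < M &
  forall c e, 0 < e -> exists r dr, is_ramp M c e r dr.
Proof.
have [M M0 hM] := derive1_step_bounded; exists M => // c e e0.
have argE y : e^-1 * y + - (c / e) = (y - c) / e by rewrite mulrBl mulrC.
exists (fun y => step (e^-1 * y + - (c / e))).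
exists (fun y => e^-1 * derive1 step (e^-1 * y + - (c / e))).
split.
- by move=> n; apply: diffn_affine; exact: diffn_step.
- by move=> y; apply: is_derive_comp_affine; exact: is_derive_step.
- by move=> y; rewrite step_ge0 step_le1.
- by move=> y yc; rewrite argE step_le0// pmulr_lle0 ?invr_gt0// subr_le0.
- by move=> y yc; rewrite argE step_ge1// ler_pdivlMr// mul1r lerBrDl.
- by move=> y; rewrite normrM gtr0_norm ?invr_gt0// mulrC ler_pM2r ?invr_gt0.
- move=> y; rewrite argE; apply: contra_neqT => yc.
  rewrite derive1_step_eq0 ?mulr0//.
  move: yc; rewrite negb_and -!ltNge => /orP[yc|yc]; apply/orP; [left|right].
    by rewrite pmulr_llt0 ?invr_gt0// subr_lt0.
  by rewrite ltr_pdivlMr// mul1r ltrBrDl.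
Qed.

End smooth.

(** * Lebesgue norms on an interval *)

Section Lp.
Context {R : realType}.
Implicit Types (p q a b : R) (D : set R) (f g : R -> R).
Local Notation mu := (@lebesgue_measure R).

Lemma Lp_normE p D f : p != 0 ->
  Lp_norm p D f = ((\int[mu]_(y in D) (`|f y| `^ p)%:E) `^ p^-1)%E.
Proof.
move=> p0; rewrite /Lp_norm unlock /= [in RHS]integral_mkcond.
congr (_ `^ _)%E; apply: eq_integral => y _ /=.
by rewrite !patchE; case: ifPn; rewrite //= normr0 powR0.
Qed.

Lemma in_LpP p D f : measurable D -> 0 < p ->
  in_Lp p D f <->
  measurable_fun D f /\ (\int[mu]_(y in D) (`|f y| `^ p)%:E < +oo)%E.
Proof.
move=> mD p0; have pn0 : p != 0 by rewrite gt_eqF.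
rewrite (measurable_restrictT _ mD).
have -> : (\int[mu]_(y in D) (`|f y| `^ p)%:E < +oo)%E <->
   (Lp_norm p D f < +oo)%E.
  rewrite Lp_normE//.
  have : (0 <= \int[mu]_(y in D) (`|f y| `^ p)%:E)%E.
    by apply: integral_ge0 => y _; rewrite lee_fin powR_ge0.
  case: (integral _ _ _) => [r r0||]//; first by rewrite poweR_EFin !ltry.
  by move=> _; rewrite poweRyr// invr_neq0.
rewrite /in_Lp; split => [/andP[]|[mf fp]].
  by rewrite !inE.
by apply/andP; split; rewrite inE.
Qed.

Lemma hoelder_on p q D f g : measurable D ->
  measurable_fun D f -> measurable_fun D g ->
  0 < p -> 0 < q -> p^-1 + q^-1 = 1 ->
  (\int[mu]_(y in D) (`|f y * g y|)%:E <= Lp_norm p D f * Lp_norm q D g)%E.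
Proof.
move=> mD mf mg p0 q0 pq.
have mfD := (measurable_restrictT f mD).1 mf.
have mgD := (measurable_restrictT g mD).1 mg.
apply: le_trans (hoelder mu mfD mgD p0 q0 pq).
rewrite Lnorm1 [leLHS]integral_mkcond le_eqVlt; apply/orP; left; apply/eqP.
apply: eq_integral => y _ /=.
by rewrite /GRing.mul_fun !patchE; case: ifPn => //; rewrite mul0r normr0.
Qed.

(** Hoelder's inequality against the constant 1, whose norm for the conjugate exponent [q] is
    [(b - a)^(1/q)]. *)
Lemma integral_norm_le_Lp_norm p a b : 1 < p -> a < b ->
  exists2 K : R, 0 < K & forall f, measurable_fun `]a, b[ f ->
  (\int[mu]_(y in `]a, b[) `|f y|%:E <= K%:E * Lp_norm p `]a, b[ f)%E.
Proof.
move=> p1 ab; have p0 : 0 < p by rewrite (lt_trans _ p1).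
pose q := (1 - p^-1)^-1.
have q0 : 0 < q by rewrite invr_gt0 subr_gt0 invf_lt1.
have pq : p^-1 + q^-1 = 1 by rewrite invrK subrKC.
exists ((b - a) `^ q^-1) => [|f mf]; first by rewrite powR_gt0// subr_gt0.
have m1 : measurable_fun `]a, b[ (cst 1 : R -> R) by exact: measurable_cst.
have := hoelder_on (measurable_itv `]a, b[) mf m1 p0 q0 pq.
rewrite muleC (Lp_normE _ _ (lt0r_neq0 q0)).
under [X in (X `^ _)%E]eq_integral do rewrite normr1 powR1.
rewrite integral_cst//= mul1e lebesgue_measure_itv/= lte_fin ab -EFinB poweR_EFin.
by under eq_integral do rewrite mulr1.
Qed.

Lemma in_Lp_integrable p a b f : 1 < p -> a < b -> in_Lp p `]a, b[ f ->
  mu.-integrable `]a, b[ (EFin \o f).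
Proof.
move=> p1 ab; have p0 : 0 < p by rewrite (lt_trans _ p1).
have [K K0 hK] := integral_norm_le_Lp_norm p1 ab.
move=> /(in_LpP _ (measurable_itv _) p0)[mf fp]; apply/integrableP; split.
  exact/measurable_EFinP.
apply: le_lt_trans (hK _ mf) _; rewrite Lp_normE ?gt_eqF//.
have : (0 <= \int[mu]_(y in `]a, b[) (`|f y| `^ p)%:E)%E.
  by apply: integral_ge0 => y _; rewrite lee_fin powR_ge0.
by case: (integral _ _ _) fp => [r _ r0||]//; rewrite poweR_EFin -EFinM ltry.
Qed.

Lemma integrable_restrictT D f : measurable D ->
  mu.-integrable D (EFin \o f) -> mu.-integrable setT (EFin \o f \_ D).
Proof.
move=> mD fD; rewrite -restrict_EFin.
exact: ((@integrable_mkcond _ _ _ mu _ (EFin \o f) mD).1 fD).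
Qed.

(** The interval is the ball of radius [(b - a) / 2] about its midpoint, and the closure of a ball
    is the closed ball. *)
Lemma closure_itvoo a b : a < b -> closure `]a, b[ = `[a, b]%classic :> set R.
Proof.
move=> ab; pose c := (a + b) / 2; pose r := (b - a) / 2.
have r0 : 0 < r by rewrite divr_gt0// subr_gt0.
have ca : c - r = a by rewrite /c /r; field.
have cb : c + r = b by rewrite /c /r; field.
by rewrite -ca -cb -ball_itv closure_ballE closed_ball_itv.
Qed.

(** A nonzero value at [c] keeps [|f|] above [|f c| / 2] on an interval of positive length, which
    contradicts the zero integral. *)
Lemma within_continuous_eq0 a b f : a < b -> {within `[a, b], continuous f} ->
  (\int[mu]_(y in `]a, b[) `|f y|%:E = 0)%E ->
  forall y, a <= y <= b -> f y = 0.
Proof.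
move=> ab cf f0 c cab; apply/eqP; apply: contraT => fc0.
have fc : 0 < `|f c| / 2 by rewrite divr_gt0 ?normr_gt0.
have mf : measurable_fun `]a, b[ f.
  apply: (@measurable_funS _ _ _ _ `[a, b]) => //.
    by apply: subset_itv_oo_cc.
  by apply: subspace_continuous_measurable_fun.
have mnf : measurable_fun `]a, b[ (fun y => `|f y|%:E).
  by apply/measurable_EFinP/measurableT_comp.
have /cvgrPdist_lt /(_ _ fc) : f @ within `[a, b] (nbhs c) --> f c.
  by move/subspace_continuousP : cf; apply; rewrite /= in_itv.
rewrite near_withinE => /nbhs_ballP[d /= d0 hd].
(* The point [c] may be [a] or [b], so the neighbourhood of [c] is cut down to the interval; it
   still has positive length. *)
pose l := Order.max a (c - d); pose r := Order.min b (c + d).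
have lr : l < r.
  rewrite /l /r; case/andP : cab => ac cb.
  by rewrite lt_min !gt_max; apply/andP; split; apply/andP; split; lra.
have lrab : `]l, r[ `<=` `]a, b[.
  move=> y; rewrite /= !in_itv/= /l /r lt_min gt_max.
  by move=> /andP[/andP[-> _] /andP[-> _]].
suff : (0 < \int[mu]_(y in `]a, b[) `|f y|%:E)%E by rewrite f0 ltxx.
apply: (@lt_le_trans _ _ (\int[mu]_(y in `]l, r[) (`|f c| / 2)%:E)%E); last first.
  apply: (@le_trans _ _ (\int[mu]_(y in `]l, r[) `|f y|%:E)%E); last first.
    by apply: ge0_subset_integral.
  apply: ge0_le_integral => //.
  - exact: measurable_funS mnf.
  move=> y ylr; rewrite lee_fin.
  have : `|f c - f y| < `|f c| / 2.
    apply: hd.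
      move: ylr; rewrite /= in_itv/= /l /r lt_min gt_max /ball/= => /andP[/andP[_ ?] /andP[_ ?]].
      by rewrite ltr_distl; lra.
    exact: subset_itv_oo_cc (lrab _ ylr).
  have := ler_normD (f c - f y) (f y); rewrite subrK; lra.
rewrite integral_cst//= lebesgue_measure_itv/= lte_fin lr -EFinB -EFinM.
by rewrite lte_fin mulr_gt0// subr_gt0.
Qed.

End Lp.

(** * Functions of W_0^{1,p} as primitives of their gradient *)

Section W01p.
Context {R : realType}.
Implicit Types (p q a b x y : R) (f g h v phi : R -> R).
Local Notation mu := (@lebesgue_measure R).

Lemma test_function_eq0 (D : set R) phi y : test_function D phi -> ~ D y -> phi y = 0.
Proof.
move=> [_ _ sD] Dy; apply/eqP; apply: contra_notT Dy => phiy.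
exact/sD/subset_closure.
Qed.

Lemma test_function_derivable (D : set R) phi y :
  test_function D phi -> derivable phi y 1.
Proof. by case=> /(_ 0 y). Qed.

Lemma test_function_continuous (D : set R) phi :
  test_function D phi -> continuous phi.
Proof.
move=> tphi y; apply: differentiable_continuous.
by apply/derivable1_diffP; exact: test_function_derivable tphi.
Qed.

Lemma test_function_derive1_continuous (D : set R) phi :
  test_function D phi -> continuous (derive1 phi).
Proof.
move=> [dphi _ _] y; apply: differentiable_continuous.
by apply/derivable1_diffP; exact: dphi 1 y.
Qed.

Lemma continuous_derivable_oo_LRcontinuous f a b :
  (forall y, derivable f y 1) -> derivable_oo_LRcontinuous f a b.
Proof.
move=> df; have cf : continuous f.
  by move=> y; apply/differentiable_continuous/derivable1_diffP.
by split; [move=> y _|apply: cvg_at_right_filter; exact: cf|apply: cvg_at_left_filter; exact: cf].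
Qed.

Lemma test_function_integral_derive1 a b phi y :
  a < b -> test_function `]a, b[ phi -> a <= y ->
  (\int[mu]_(t in `[a, y]) (derive1 phi t)%:E = (phi y)%:E)%E.
Proof.
move=> ab tphi; have phia : phi a = 0.
  by apply: test_function_eq0 tphi _; rewrite /= in_itv/= ltxx.
rewrite le_eqVlt => /predU1P[<-|ay].
  by rewrite set_itv1 integral_set1 phia.
rewrite (continuous_FTC2 ay _ (F := phi)) ?phia ?sube0//.
  apply: continuous_subspaceT; exact: test_function_derive1_continuous tphi.
apply: continuous_derivable_oo_LRcontinuous => t.
exact: test_function_derivable tphi.
Qed.

(** A test function is the primitive of its derivative, so closeness of [h] to [derive1 phi] in L^1
    bounds [w - phi] uniformly. The same [phi] is close to [v] in L^1, which ties [v] to [w]. *)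
Lemma W01p_primitive_approx p a b v h : 1 < p -> a < b ->
  sobolev_W01p p `]a, b[ v h ->
  let w y := (\int[mu]_(t in `[a, y]) (h \_ `]a, b[) t) in
  exists2 C : R, 0 < C & forall e, 0 < e -> exists phi,
    [/\ test_function `]a, b[ phi,
     (\int[mu]_(y in `]a, b[) (`|v y - phi y|)%:E <= (C * e)%:E)%E &
     forall y, a <= y <= b -> `|w y - phi y| <= C * e].
Proof.
move=> p1 ab [_ [vp hp _] dens] w.
have p0 : 0 < p by rewrite (lt_trans _ p1).
have [K K0 hK] := integral_norm_le_Lp_norm p1 ab.
have /(in_LpP _ (measurable_itv _) p0)[mv _] := vp.
have ih := in_Lp_integrable p1 ab hp.
have mh : measurable_fun `]a, b[ h by apply/measurable_EFinP; exact: measurable_int ih.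
have iH : mu.-integrable setT (EFin \o h \_ `]a, b[).
  exact: integrable_restrictT.
exists K => // e e0; have [phi tphi hphi] := dens _ e0; exists phi.
have cphi := test_function_continuous tphi.
have cphi' := test_function_derive1_continuous tphi.
have mphi : measurable_fun `]a, b[ phi.
  by apply: measurable_funTS; exact: continuous_measurable_fun.
have mphi' : measurable_fun setT (derive1 phi) by exact: continuous_measurable_fun.
(* Each of the two norms in the W^{1,p} distance is at most [e], so this passage from L^p to L^1
   serves for both [v - phi] and [h - phi']. *)
have Ne (f : R -> R) : measurable_fun `]a, b[ f ->
    (Lp_norm p `]a, b[ f <= e%:E ->
    \int[mu]_(y in `]a, b[) (`|f y|)%:E <= (K * e)%:E)%E.
  move=> mf fe; apply: le_trans (hK _ mf) _.
  by rewrite EFinM lee_pmul2l.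
split => //.
  apply: (Ne (v \- phi)); first exact: measurable_funB.
  by apply: le_trans (ltW hphi); rewrite leeDl// Lnorm_ge0.
move=> y /andP[ay yb].
have ab_sub : `[a, y] `<=` `[a, b] by apply: subset_itvl; rewrite bnd_simp.
have i1 : mu.-integrable `[a, y] (EFin \o h \_ `]a, b[).
  exact: integrableS iH.
have i2 : mu.-integrable `[a, y] (EFin \o derive1 phi).
  apply: continuous_compact_integrable; first exact: segment_compact.
  exact: continuous_subspaceT.
have i2' : mu.-integrable `[a, b] (EFin \o derive1 phi).
  apply: continuous_compact_integrable; first exact: segment_compact.
  exact: continuous_subspaceT.
have mB (D : set R) : measurable D -> measurable_fun D (fun t => (h \_ `]a, b[) t - derive1 phi t).
  move=> mD; apply: measurable_funTS; apply: measurable_funB => //.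
  by apply/measurable_EFinP; exact: measurable_int iH.
rewrite -lee_fin -abse_EFin EFinB fineK; last exact: integrable_fin_num.
rewrite -(test_function_integral_derive1 ab tphi ay).
rewrite -integralB_EFin//.
apply: le_trans (le_abse_integral _ _ _) _ => //.
  by apply/measurable_EFinP; exact: mB.
apply: (@le_trans _ _ (\int[mu]_(t in `[a, b]) `|(h \_ `]a, b[) t - derive1 phi t|%:E)%E).
  apply: ge0_subset_integral => //.
  by apply/measurable_EFinP/measurableT_comp => //; exact: mB.
rewrite integral_itv_bndoo; last first.
  by apply/measurable_EFinP/measurableT_comp => //; exact: mB.
under eq_integral => t tab do rewrite patchE tab.
apply: (Ne (h \- derive1 phi)); first by apply: measurable_funB => //; exact: measurable_funTS.
by apply: le_trans (ltW hphi); rewrite leeDr// Lnorm_ge0.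
Qed.

(** As the approximation improves, [w b] is a limit of values [phi b = 0], and [v - w] has zero L^1
    norm. Both functions are continuous on [[a, b]], so they agree everywhere there, endpoints
    included. *)
Lemma W01p_primitive p a b v h : 1 < p -> a < b ->
  sobolev_W01p p `]a, b[ v h ->
  (forall y, a <= y <= b -> v y = \int[mu]_(t in `[a, y]) (h \_ `]a, b[) t)
  /\ v b = 0.
Proof.
move=> p1 ab vh; have [C C0 approx] := W01p_primitive_approx p1 ab vh.
case: vh => cv [vp hp _] _; move: approx.
set w := (fun y => \int[mu]_(t in `[a, y]) (h \_ `]a, b[) t) => approx.
have p0 : 0 < p by rewrite (lt_trans _ p1).
have /(in_LpP _ (measurable_itv _) p0)[mv _] := vp.
have ih := in_Lp_integrable p1 ab hp.
have iH : mu.-integrable `[a, b] (EFin \o h \_ `]a, b[).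
  have : mu.-integrable setT (EFin \o h \_ `]a, b[).
    exact: integrable_restrictT.
  exact: integrableS.
have cw : {within `[a, b], continuous w}.
  exact: parameterized_integral_continuous (ltW ab) iH.
have mw : measurable_fun `]a, b[ w.
  apply: (@measurable_funS _ _ _ _ `[a, b]) => //.
    by apply: subset_itv_oo_cc.
  by apply: subspace_continuous_measurable_fun.
have wb : w b = 0.
  apply/eqP; rewrite -normr_le0; apply/ler_addgt0Pr => e e0.
  have [phi [tphi _ /(_ b)]] := approx _ (divr_gt0 e0 C0).
  rewrite lexx ltW// => /(_ isT).
  rewrite (_ : phi b = 0); last first.
    by apply: test_function_eq0 tphi _; rewrite /= in_itv/= ltxx andbF.
  by rewrite subr0 mulrC divfK ?gt_eqF// add0r.
suff vw y : a <= y <= b -> v y = w y.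
  by split=> //; rewrite vw ?wb// lexx ltW.
move=> yab; apply/eqP; rewrite -subr_eq0; apply/eqP.
apply: (@within_continuous_eq0 _ a b (fun y => v y - w y)) => //.
  rewrite -closure_itvoo//.
  by move=> z; apply: cvgB; [exact: cv|rewrite closure_itvoo//; exact: cw].
apply/eqP; rewrite eq_le integral_ge0 ?andbT; last by move=> t _; rewrite lee_fin.
apply/lee_addgt0Pr => e e0; rewrite add0e.
(* The L^1 distance from [v] to [phi] costs [C * e'], and the uniform distance from [phi] to [w]
   costs [C * e' * (b - a)]; dividing [e] by [C * (1 + (b - a))] makes the total [e]. *)
have D0 : 0 < C * (1 + (b - a)) by rewrite mulr_gt0// addr_gt0// subr_gt0.
have [phi [tphi vphi wphi]] := approx _ (divr_gt0 e0 D0).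
have mphi : measurable_fun `]a, b[ phi.
  apply: measurable_funTS; apply: continuous_measurable_fun.
  exact: test_function_continuous tphi.
set e' := e / _ in vphi wphi.
apply: (@le_trans _ _ (\int[mu]_(t in `]a, b[) (`|v t - phi t|%:E + (C * e')%:E))%E).
  apply: ge0_le_integral => //.
  - by apply/measurable_EFinP/measurableT_comp => //; exact: measurable_funB.
  - apply: emeasurable_funD => //.
    by apply/measurable_EFinP/measurableT_comp => //; exact: measurable_funB.
  move=> t; rewrite /= in_itv/= => /andP[ta tb].
  rewrite -EFinD lee_fin; have /wphi : a <= t <= b by rewrite !ltW.
  rewrite distrC => h1; apply: le_trans (lerD (lexx _) h1).
  by apply: le_trans (ler_normD _ _); rewrite addrA subrK.
rewrite ge0_integralD//.
- rewrite integral_cst//= lebesgue_measure_itv/= lte_fin ab -EFinB -EFinM.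
  apply: le_trans (leeD vphi (lexx _)) _; rewrite -EFinD lee_fin.
  by rewrite -[X in X + _]mulr1 -mulrDr mulrAC mulrC divfK// gt_eqF.
- by apply/measurable_EFinP/measurableT_comp => //; exact: measurable_funB.
- move=> t _; rewrite lee_fin ltW// mulr_gt0// divr_gt0//.
Qed.

End W01p.

(** * The p-Laplacian flux and piecewise constant functions *)

Section flux.
Context {R : realType}.
Implicit Types (p q a b x y s t : R) (f g h v u phi : R -> R).
Local Notation mu := (@lebesgue_measure R).

Definition flux p s : R := `|s| `^ (p - 2) * s.

Lemma ger0_flux p s : 1 < p -> 0 <= s -> flux p s = s `^ (p - 1).
Proof.
move=> p1; rewrite le_eqVlt => /predU1P[<-|s0].
  by rewrite /flux mulr0 powR0// gt_eqF// subr_gt0.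
rewrite /flux gtr0_norm// -{2}[s]powRr1 ?ltW// -powRD; first by congr (_ `^ _); ring.
by rewrite (gt_eqF s0) implybT.
Qed.

Lemma fluxN p s : flux p (- s) = - flux p s.
Proof. by rewrite /flux normrN mulrN. Qed.

Lemma norm_flux p s : 1 < p -> `|flux p s| = `|s| `^ (p - 1).
Proof.
move=> p1; rewrite -ger0_flux// /flux normr_id normrM.
by rewrite (ger0_norm (powR_ge0 _ _)).
Qed.

Lemma fluxM p s : 1 < p -> flux p s * s = `|s| `^ p.
Proof.
move=> p1; have [s0|s0] := leP 0 s.
  rewrite ger0_flux// ger0_norm// mulrC mulr_powRB1//; lra.
rewrite -[s]opprK fluxN mulrNN normrN.
rewrite ger0_norm ?oppr_ge0 ?ltW// ger0_flux ?oppr_ge0 ?ltW//.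
by rewrite mulrC mulr_powRB1//; lra.
Qed.

(** The flux is odd, so one may assume [0 < t]: otherwise the pair [(- t, - s)] has a positive
    larger entry. On nonnegative numbers the flux is the increasing power [p - 1]. *)
Lemma flux_lt p s t : 1 < p -> s < t -> flux p s < flux p t.
Proof.
move=> p1; wlog t0 : s t / 0 < t => [hw st|st].
  have [t0|t0] := ltP 0 t; first exact: hw.
  have : flux p (- t) < flux p (- s) by apply: hw; lra.
  by rewrite !fluxN ltrN2.
rewrite (ger0_flux p1 (ltW t0)); have [s0|s0] := leP 0 s.
  rewrite ger0_flux// gt0_ltr_powR// ?nnegrE//; lra.
apply: (@lt_trans _ _ 0); last by rewrite powR_gt0.
by rewrite -[s]opprK fluxN oppr_lt0 ger0_flux ?powR_gt0; lra.
Qed.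

(** The sign and the equality case serve together in the uniqueness proof: the first turns a zero
    integral into an integrand that vanishes a.e., the second turns this into equality of the
    gradients. *)
Lemma flux_monotone p s t : 1 < p ->
  0 <= (flux p s - flux p t) * (s - t) ?= iff (s == t).
Proof.
move=> p1; split; last first.
  have [->|st] := eqVneq s t; first by rewrite !subrr mulr0 eqxx.
  rewrite eq_sym mulf_eq0 !subr_eq0 (negbTE st) orbF; apply/negbTE.
  have [/(flux_lt p1)|/(flux_lt p1)|/eqP] := ltgtP s t; last by rewrite (negbTE st).
    by move/lt_eqF ->.
  by move/gt_eqF ->.
have [st|st|->] := ltgtP s t; last by rewrite subrr mul0r.
- by have h := flux_lt p1 st; rewrite -mulrNN mulr_ge0//; lra.
- by have h := flux_lt p1 st; rewrite mulr_ge0//; lra.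
Qed.

(** Common shape of the gradient of the hat and of its flux. The value at [x] is the left one, so
    the natural splitting is into []a, x]] and []x, b[]. *)
Definition jump x (k l : R) y : R := if y <= x then k else l.

Lemma measurable_jump (D : set R) x k l : measurable_fun D (jump x k l).
Proof.
apply: measurable_funTS; apply: measurable_fun_ifT => //.
exact: measurable_fun_ler.
Qed.

Lemma jump_comp (f : R -> R) x k l y : f (jump x k l y) = jump x (f k) (f l) y.
Proof. by rewrite /jump; case: ifP. Qed.

Lemma integrable_jumpM (D : set R) x k l h : measurable D ->
  mu.-integrable D (EFin \o h) ->
  mu.-integrable D (fun y => (jump x k l y * h y)%:E).
Proof.
move=> mD ih; have mh : measurable_fun D h.
  by apply/measurable_EFinP; exact: measurable_int ih.
pose M := `|k| + `|l|.
apply: (@le_integrable _ _ _ mu _ mD _ (fun y => M%:E * (h y)%:E)%E) => //.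
- by apply/measurable_EFinP; apply: measurable_funM => //; exact: measurable_jump.
- move=> y _; rewrite -EFinM !abse_EFin lee_fin !normrM ler_wpM2r//.
  rewrite (ger0_norm (addr_ge0 _ _))// /jump.
  by case: ifP => _; rewrite ?lerDl ?lerDr.
- exact: integrableZl.
Qed.

Lemma integral_jump a b x k l : a < x < b ->
  (\int[mu]_(y in `]a, b[) (jump x k l y)%:E = (k * (x - a) + l * (b - x))%:E)%E.
Proof.
move=> /andP[ax xb].
have ab : a < b by exact: lt_trans xb.
have i1 : mu.-integrable `]a, b[ (EFin \o (cst 1 : R -> R)).
  apply/integrableP; split; first by apply/measurable_EFinP.
  under eq_integral do rewrite abse_EFin normr1.
  by rewrite integral_cst//= mul1e lebesgue_measure_itv/= lte_fin ab -EFinB ltry.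
have iJ := integrable_jumpM x k l (measurable_itv _) i1.
have {i1}iJ : mu.-integrable `]a, b[ (EFin \o jump x k l).
  by apply: eq_integrable iJ => // y _ /=; rewrite mulr1.
rewrite -[LHS]fineK; last exact: integrable_fin_num.
congr EFin; rewrite -/(Rintegral mu `]a, b[ (jump x k l)).
have := Rintegral_itvB iJ; move=> /(_ x); rewrite !bnd_simp => /(_ (ltW ax) xb) => /eqP.
rewrite subr_eq => /eqP ->.
rewrite (@eq_Rintegral _ _ _ mu `]x, b[ (cst l)); last first.
  by move=> y; rewrite inE/= in_itv/= /jump => /andP[xy _]; rewrite leNgt xy.
rewrite (@eq_Rintegral _ _ _ mu `]a, x] (cst k)); last first.
  by move=> y; rewrite inE/= in_itv/= /jump => /andP[_ ->].
rewrite !Rintegral_cst//= !lebesgue_measure_itv/= !lte_fin ax xb -!EFinB /=.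
by rewrite addrC.
Qed.

(** The integral of [h] is [v x] over []a, x]] and [v b - v x = - v x] over []x, b[], so a jump of
    size [k - l] acts on gradients as a multiple of the Dirac mass at [x]. *)
Lemma W01p_pairing p a b x v h (k l : R) : 1 < p -> a < x < b ->
  sobolev_W01p p `]a, b[ v h ->
  (\int[mu]_(y in `]a, b[) (jump x k l y * h y)%:E = ((k - l) * v x)%:E)%E.
Proof.
move=> p1 /andP[ax xb] vh.
have ab : a < b by exact: lt_trans xb.
have [vE vb] := W01p_primitive p1 ab vh.
have [_ [_ hp _] _] := vh.
have ih := in_Lp_integrable p1 ab hp.
have iJ := integrable_jumpM x k l (measurable_itv _) ih.
have sub1 : `]a, x] `<=` `]a, b[ by apply: subset_itvl; rewrite bnd_simp.
have sub2 : `]x, b[ `<=` `]a, b[ by apply: subset_itvr; rewrite bnd_simp ltW.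
have i1 : mu.-integrable `]a, x] (EFin \o h) by exact: integrableS ih.
have i2 : mu.-integrable `]x, b[ (EFin \o h) by exact: integrableS ih.
have iH : mu.-integrable setT (EFin \o h \_ `]a, b[).
  exact: integrable_restrictT.
have h1 : \int[mu]_(y in `]a, x]) h y = v x.
  rewrite vE ?(ltW ax) ?(ltW xb)// -Rintegral_itv_obnd_cbnd; last first.
    exact: integrableS iH.
  by apply: eq_Rintegral => y yax; rewrite patchE mem_set//; apply: sub1; rewrite inE in yax.
have hb : \int[mu]_(y in `]a, b[) h y = 0.
  rewrite -vb vE ?lexx ?(ltW ab)// -Rintegral_itv_obnd_cbnd; last first.
    exact: integrableS iH.
  rewrite -Rintegral_itv_bndo_bndc; last exact: integrableS iH.
  by apply: eq_Rintegral => y yax; rewrite patchE yax.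
have h2 : \int[mu]_(y in `]x, b[) h y = - v x.
  have := Rintegral_itvB ih; move=> /(_ x); rewrite !bnd_simp => /(_ (ltW ax) xb) <-.
  by rewrite hb h1 sub0r.
rewrite -[LHS]fineK; last exact: integrable_fin_num.
congr EFin; rewrite -/(Rintegral mu `]a, b[ (fun y => jump x k l y * h y)).
have := Rintegral_itvB iJ; move=> /(_ x); rewrite !bnd_simp => /(_ (ltW ax) xb) => /eqP.
rewrite subr_eq => /eqP ->.
rewrite (@eq_Rintegral _ _ _ mu `]x, b[ (fun y => l * h y)); last first.
  by move=> y; rewrite inE/= in_itv/= /jump => /andP[xy _]; rewrite leNgt xy.
rewrite (@eq_Rintegral _ _ _ mu `]a, x] (fun y => k * h y)); last first.
  by move=> y; rewrite inE/= in_itv/= /jump => /andP[_ ->].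
by rewrite !RintegralZl// h1 h2; ring.
Qed.

End flux.

(** * Optimality and uniqueness of the hat function *)

Section hat.
Context {R : realType}.
Variables (p a b x : R).
Hypotheses (p1 : 1 < p) (axb : a < x < b).
Implicit Types (y s t : R) (f g h v u phi : R -> R).
Local Notation mu := (@lebesgue_measure R).

Definition hat_slope : R -> R := jump x (x - a)^-1 (- (b - x)^-1).

(** This is the constant [s_p(x)^(-p)]: at once the jump of the flux of the hat at [x] and the
    integral of [|hat_slope|^p]. *)
Definition hat_weight : R := (x - a) `^ (1 - p) + (b - x) `^ (1 - p).

Let p0 : 0 < p. Proof. exact: lt_trans p1. Qed.
Let ab : a < b. Proof. by case/andP: axb; exact: lt_trans. Qed.
Let xa0 : 0 < x - a. Proof. by case/andP: axb; lra. Qed.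
Let bx0 : 0 < b - x. Proof. by case/andP: axb; lra. Qed.

Lemma hat_weight_gt0 : 0 < hat_weight.
Proof. by rewrite addr_gt0// powR_gt0. Qed.

Lemma flux_inv s : 0 < s -> flux p s^-1 = s `^ (1 - p).
Proof.
move=> s0; rewrite ger0_flux// ?invr_ge0 ?ltW// -powR_inv1 ?ltW// -powRrM.
by congr (_ `^ _); ring.
Qed.

Lemma flux_hat_slope y :
  flux p (hat_slope y) = jump x ((x - a) `^ (1 - p)) (- (b - x) `^ (1 - p)) y.
Proof. by rewrite /hat_slope (jump_comp (flux p)) fluxN !flux_inv. Qed.

Lemma integral_flux_hat_slope v h : sobolev_W01p p `]a, b[ v h ->
  (\int[mu]_(y in `]a, b[) (flux p (hat_slope y) * h y)%:E =
   (hat_weight * v x)%:E)%E.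
Proof.
move=> vh; under eq_integral do rewrite flux_hat_slope.
by rewrite (W01p_pairing _ _ p1 axb vh) opprK.
Qed.

Lemma integral_hat_slope_powR :
  (\int[mu]_(y in `]a, b[) (`|hat_slope y| `^ p)%:E = hat_weight%:E)%E.
Proof.
have powRNp s : 0 < s -> `|s^-1| `^ p * s = s `^ (1 - p).
  move=> s0; rewrite ger0_norm ?invr_ge0 ?ltW// -powR_inv1 ?ltW// -powRrM mulN1r.
  rewrite -{2}[s]powRr1 ?ltW// -powRD ?(gt_eqF s0) ?implybT//.
  by rewrite addrC.
under eq_integral do rewrite /hat_slope (jump_comp (fun s => `|s| `^ p)) normrN.
by rewrite integral_jump// !powRNp.
Qed.

Lemma Lp_norm_hat_slope : Lp_norm p `]a, b[ hat_slope = (hat_weight `^ p^-1)%:E.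
Proof. by rewrite Lp_normE ?gt_eqF// integral_hat_slope_powR. Qed.

(** Hoelder bounds [c * |v x|] by the L^q norm of the flux times the L^p norm of [h]. The former is
    [c^(1/q)], and [1/q - 1 = - 1/p] gives the exponent. *)
Lemma W01p_norm_le v h : sobolev_W01p p `]a, b[ v h ->
  `|v x| <= hat_weight `^ (- p^-1) * fine (Lp_norm p `]a, b[ h).
Proof.
move=> vh; have [_ [_ hp _] _] := vh.
have [mh hfin] := (in_LpP _ (measurable_itv _) p0).1 hp.
have ih := in_Lp_integrable p1 ab hp.
pose q := (1 - p^-1)^-1.
have q0 : 0 < q by rewrite invr_gt0 subr_gt0 invf_lt1.
have pq : q^-1 + p^-1 = 1 by rewrite invrK subrK.
(* Conjugacy in this form turns [|flux|^q] into [|hat_slope|^p], whose integral is known. *)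
have pq1 : (p - 1) * q = p.
  rewrite /q; have -> : p - 1 = p * (1 - p^-1) by rewrite mulrBr mulr1 divff// gt_eqF.
  by rewrite mulfK// gt_eqF// subr_gt0 invf_lt1.
have mflux : measurable_fun `]a, b[ (flux p \o hat_slope).
  rewrite (_ : _ \o _ = jump x ((x - a) `^ (1 - p)) (- (b - x) `^ (1 - p))); last first.
    by apply/funext => y; exact: flux_hat_slope.
  exact: measurable_jump.
have := hoelder_on (measurable_itv `]a, b[) mflux mh q0 p0 pq.
have -> : Lp_norm q `]a, b[ (flux p \o hat_slope) = (hat_weight `^ q^-1)%:E.
  rewrite Lp_normE ?gt_eqF//.
  under eq_integral do rewrite /= norm_flux// -powRrM pq1.
  by rewrite integral_hat_slope_powR.
have : (0 <= Lp_norm p `]a, b[ h)%E by exact: Lnorm_ge0.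
have : (Lp_norm p `]a, b[ h < +oo)%E.
  rewrite Lp_normE ?gt_eqF//.
  by apply: poweR_lty; exact: hfin.
case: (Lp_norm p `]a, b[ h) => [n||]//= _; rewrite lee_fin => n0 hh.
have hb : (`|(hat_weight * v x)%:E| <=
    \int[mu]_(y in `]a, b[) (`|(flux p \o hat_slope) y * h y|)%:E)%E.
  rewrite -(integral_flux_hat_slope vh).
  apply: (le_abse_integral mu (measurable_itv _)).
  by apply/measurable_EFinP/measurable_funM.
have := le_trans hb hh.
rewrite -EFinM lee_fin normrM (gtr0_norm hat_weight_gt0) => le1.
rewrite powRN mulrC ler_pdivlMr ?powR_gt0 ?hat_weight_gt0//.
rewrite -(@ler_pM2l _ (hat_weight `^ q^-1)) ?powR_gt0 ?hat_weight_gt0//.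
rewrite mulrCA -powRD; last by rewrite (gt_eqF hat_weight_gt0) implybT.
by rewrite pq (powRr1 (ltW hat_weight_gt0)) mulrC.
Qed.

Lemma s_hatE u : sobolev_W01p p `]a, b[ u hat_slope -> u x = 1 ->
  s_ p `]a, b[ x = (hat_weight `^ (- p^-1))%:E.
Proof.
move=> uW ux; apply/eqP; rewrite eq_le; apply/andP; split.
  apply: ge_ereal_sup => _ [v [h [vW _ ->]]]; rewrite lee_fin.
  have : 0 <= fine (Lp_norm p `]a, b[ h) by apply/fine_ge0/Lnorm_ge0.
  (* If the gradient has norm 0, the quotient is 0 by the convention [0^-1 = 0], and the bound is
     trivial. *)
  rewrite le_eqVlt => /predU1P[<-|N0]; first by rewrite invr0 mulr0 powR_ge0.
  by rewrite ler_pdivrMr// W01p_norm_le.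
apply: ereal_sup_ubound; exists u, hat_slope; split => //.
  by exists x; rewrite ?ux ?oner_neq0//= in_itv.
by rewrite ux normr1 Lp_norm_hat_slope /= div1r powRN.
Qed.

Lemma weak_solution_hat u uh : sobolev_W01p p `]a, b[ uh hat_slope -> uh x = 1 ->
  weak_p_laplace_dirac p `]a, b[ hat_weight x u ->
  forall y, a <= y <= b -> u y = uh y.
Proof.
move=> uhW uhx [g uW weak] y /andP[ay yb].
have [[uE _] [uhE _]] := (W01p_primitive p1 ab uW, W01p_primitive p1 ab uhW).
have yab : a <= y <= b by rewrite ay yb.
rewrite uE// uhE//.
have [_ [_ gp _] _] := uW; have [_ [_ ghp _] _] := uhW.
have [mg gfin] := (in_LpP _ (measurable_itv _) p0).1 gp.
have [mgh ghfin] := (in_LpP _ (measurable_itv _) p0).1 ghp.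
have mpow f : measurable_fun `]a, b[ f -> measurable_fun `]a, b[ (fun y => `|f y| `^ p).
  move=> mf; apply: (measurableT_comp (measurable_powR p)).
  exact: measurableT_comp.
have mflux f : measurable_fun `]a, b[ f -> measurable_fun `]a, b[ (fun y => flux p (f y)).
  move=> mf; apply: measurable_funM => //; apply: (measurableT_comp (measurable_powR _)).
  exact: measurableT_comp.
have i1 : mu.-integrable `]a, b[ (EFin \o fun y => `|g y| `^ p).
  apply/integrableP; split; first by apply/measurable_EFinP; exact: mpow.
  by under eq_integral do rewrite /= ger0_norm ?powR_ge0//.
have i2 : mu.-integrable `]a, b[ (EFin \o fun y => flux p (g y) * hat_slope y).
  (* The flux of [g] is dominated by [1 + |g|^p], as [|s|^(p-1)] is at most 1 or at most [|s|^p]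
     according to the size of [|s|]. *)
  have i1' : mu.-integrable `]a, b[ (EFin \o fun y => flux p (g y)).
    have i0 : mu.-integrable `]a, b[ (EFin \o (cst 1 : R -> R)).
      apply/integrableP; split; first by apply/measurable_EFinP.
      under eq_integral do rewrite /= normr1.
      by rewrite integral_cst//= mul1e lebesgue_measure_itv/= lte_fin ab -EFinB ltry.
    apply: (le_integrable _ _ _ (integrableD _ i0 i1)) => //.
      by apply/measurable_EFinP; exact: mflux.
    move=> z _ /=; rewrite lee_fin norm_flux// (ger0_norm (addr_ge0 _ (powR_ge0 _ _)))//.
    have [gz1|gz1] := leP 1 `|g z|.
      by rewrite ler_wpDl// ler_powR//; lra.
    rewrite ler_wpDr ?powR_ge0//.
    have pm : 0 <= p - 1 by rewrite subr_ge0 ltW.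
    have := @ge0_ler_powR _ (p - 1) pm `|g z| 1; rewrite powR1 !nnegrE.
    by rewrite normr_ge0 ler01 (ltW gz1); apply.
  apply: (@eq_integrable _ _ _ mu _ (measurable_itv _) _ _ _
    (integrable_jumpM x (x - a)^-1 (- (b - x)^-1) (measurable_itv _) i1')).
  by move=> z _ /=; rewrite mulrC.
have i3 : mu.-integrable `]a, b[ (EFin \o fun y => flux p (hat_slope y) * g y).
  apply: (@eq_integrable _ _ _ mu _ (measurable_itv _) _ _ _
    (integrable_jumpM x ((x - a) `^ (1 - p)) (- (b - x) `^ (1 - p))
       (measurable_itv _) (in_Lp_integrable p1 ab gp))).
  by move=> z _ /=; rewrite flux_hat_slope.
have i4 : mu.-integrable `]a, b[ (EFin \o fun y => `|hat_slope y| `^ p).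
  apply/integrableP; split; first by apply/measurable_EFinP; exact: mpow.
  by under eq_integral do rewrite /= ger0_norm ?powR_ge0//.
pose J y := (flux p (g y) - flux p (hat_slope y)) * (g y - hat_slope y).
have JE : J = ((fun y => `|g y| `^ p) \- (fun y => flux p (g y) * hat_slope y)) \+
   ((fun y => `|hat_slope y| `^ p) \- (fun y => flux p (hat_slope y) * g y)).
  by apply/funext => z; rewrite /J /= -!fluxM//; ring.
have i12 := @integrableB _ _ _ mu _ (measurable_itv _) _ _ i1 i2.
have i43 := @integrableB _ _ _ mu _ (measurable_itv _) _ _ i4 i3.
have iJ : mu.-integrable `]a, b[ (EFin \o J).
  rewrite JE.
  exact: (@integrableD _ _ _ mu _ (measurable_itv _) _ _ i12 i43).
(* The four integrals in the expansion of [J] are [c * u x], [c], [c] and [c * u x], with signs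
   [+ - + -]: each equation is tested with both [u] and [uh]. *)
have J0 : (\int[mu]_(y in `]a, b[) (J y)%:E = 0)%E.
  rewrite JE (@integralD_EFin _ _ _ mu _ (measurable_itv _) _ _ i12 i43).
  rewrite !integralB_EFin//.
  rewrite integral_hat_slope_powR (integral_flux_hat_slope uW).
  under eq_integral do rewrite -fluxM//.
  rewrite (weak _ _ uW) (weak _ _ uhW) uhx mulr1.
  by rewrite -!EFinB -EFinD; congr EFin; ring.
have Jge0 z : 0 <= J z by exact: (flux_monotone _ _ p1).1.
have [Jae _] := @ae_eq_integral_abs _ _ _ mu _ (measurable_itv `]a, b[) _ (measurable_int mu iJ).
have {}Jae : {ae mu, forall z, `]a, b[%classic z -> (J z)%:E = 0%E}.
  by apply: Jae; under eq_integral do rewrite /= ger0_norm//.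
(* Both values are primitives of gradients, so equality a.e. of the gradients is enough. *)
congr fine; apply: ae_eq_integral => //.
- apply/measurable_EFinP; apply: measurable_funTS.
  exact/(measurable_restrictT _ (measurable_itv _)).
- apply/measurable_EFinP; apply: measurable_funTS.
  exact/(measurable_restrictT _ (measurable_itv _)).
move: Jae; apply: filterS; first exact: (ae_filter_ringOfSetsType mu).
move=> z /= Jz _; rewrite !patchE; case: ifPn => // zab.
have /eqP := Jz (set_mem zab); rewrite eqe eq_sym (flux_monotone _ _ p1).2.
by move/eqP ->.
Qed.

End hat.

(** * The hat function belongs to W_0^{1,p} *)

Section hat_W01p.
Context {R : realType}.
Variables (p a b x : R) (u : R -> R).
Hypotheses (p1 : 1 < p) (axb : a < x < b).
Hypothesis uL : forall y, a <= y <= x -> u y = (y - a) * (x - a)^-1.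
Hypothesis uR : forall y, x <= y <= b -> u y = (b - y) * (b - x)^-1.
Implicit Types (y s t e : R) (f g h v phi : R -> R).
Local Notation mu := (@lebesgue_measure R).

Let p0 : 0 < p. Proof. exact: lt_trans p1. Qed.
Let ab : a < b. Proof. by case/andP: axb; exact: lt_trans. Qed.
Let xa0 : 0 < x - a. Proof. by case/andP: axb; lra. Qed.
Let bx0 : 0 < b - x. Proof. by case/andP: axb; lra. Qed.
Let r1 := (x - a)^-1.
Let r2 := (b - x)^-1.
Let r1_gt0 : 0 < r1. Proof. by rewrite invr_gt0. Qed.
Let r2_gt0 : 0 < r2. Proof. by rewrite invr_gt0. Qed.
Let r1E : r1 * (x - a) = 1. Proof. by rewrite mulVf// gt_eqF. Qed.
Let r2E : r2 * (b - x) = 1. Proof. by rewrite mulVf// gt_eqF. Qed.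

(** On [[a, b]] the hat is the minimum of its two affine branches, which both equal 1 at [x]; this
    avoids gluing at [x]. *)
Lemma hat_within_continuous : {within `[a, b], continuous u}.
Proof.
pose m y := Order.min ((y - a) * r1) ((b - y) * r2).
apply: (@subspace_eq_continuous _ _ _ m).
  move=> y; rewrite inE/= in_itv/= => /andP[ay yb].
  rewrite /from_subspace /m; have [yx|xy] := leP y x.
    rewrite uL ?ay// min_l//.
    apply: (@le_trans _ _ 1).
      by rewrite -r1E mulrC ler_pM2l// lerD2r.
    by rewrite -r2E mulrC ler_pM2r// lerD2l lerN2.
  rewrite uR ?yb ?andbT ?(ltW xy)// min_r//.
  apply: (@le_trans _ _ 1).
    by rewrite -r2E mulrC ler_pM2l// lerD2l lerN2 ltW.
  by rewrite -r1E mulrC ler_pM2r// lerD2r ltW.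
have cL : continuous (fun y : R => (y - a) * r1).
  by move=> y; apply: cvgM; [apply: cvgB; [exact: cvg_id|exact: cvg_cst]|exact: cvg_cst].
have cR : continuous (fun y : R => (b - y) * r2).
  by move=> y; apply: cvgM; [apply: cvgB; [exact: cvg_cst|exact: cvg_id]|exact: cvg_cst].
by apply: continuous_subspaceT => y; exact: continuous_min (cL y) (cR y).
Qed.

Lemma hat_norm_le1 y : a <= y <= b -> `|u y| <= 1.
Proof.
move=> /andP[ay yb]; have [yx|/ltW xy] := leP y x.
  rewrite uL ?ay// ger0_norm; last by apply: divr_ge0; lra.
  by rewrite ler_pdivrMr// mul1r lerD2r.
rewrite uR ?xy// ger0_norm; last by apply: divr_ge0; lra.
by rewrite ler_pdivrMr// mul1r lerD2l lerN2.
Qed.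

Lemma measurable_hat : measurable_fun `]a, b[ u.
Proof.
apply: (@measurable_funS _ _ _ _ `[a, b]) => //.
  exact: subset_itv_oo_cc.
apply: subspace_continuous_measurable_fun => //.
exact: hat_within_continuous.
Qed.

Lemma hat_in_Lp : in_Lp p `]a, b[ u.
Proof.
apply/(in_LpP _ (measurable_itv _) p0); split; first exact: measurable_hat.
apply: (@le_lt_trans _ _ (\int[mu]_(y in `]a, b[) (cst 1%E y))%E); last first.
  by rewrite integral_cst//= mul1e lebesgue_measure_itv/= lte_fin ab -EFinB ltry.
apply: ge0_le_integral => //.
  apply/measurable_EFinP; apply: (measurableT_comp (measurable_powR p)).
  exact: measurableT_comp measurable_hat.
move=> y; rewrite /= in_itv/= lee_fin => /andP[ay yb].
have uy : `|u y| <= 1 by apply: hat_norm_le1; rewrite !ltW.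
have := @ge0_ler_powR _ p (ltW p0) `|u y| 1.
by rewrite powR1 !nnegrE normr_ge0 ler01 uy; apply.
Qed.

Lemma hat_slope_in_Lp : in_Lp p `]a, b[ (hat_slope a b x).
Proof.
apply/(in_LpP _ (measurable_itv _) p0); split; first exact: measurable_jump.
by rewrite integral_hat_slope_powR// ltry.
Qed.

(** Integration by parts on a single affine piece: the integrand is the derivative of
    [(k y + c) phi]. *)
Lemma integral_affine_test_function phi (k c s t : R) :
  test_function `]a, b[ phi -> s < t ->
  \int[mu]_(y in `[s, t]) ((k * y + c) * derive1 phi y + k * phi y) =
  (k * t + c) * phi t - (k * s + c) * phi s.
Proof.
move=> tphi st.
pose F := (fun y : R => k * y + c) * phi.
have dF y : is_derive y (1:R) F ((k * y + c) * derive1 phi y + k * phi y).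
  have dphi : is_derive y (1:R) phi (derive1 phi y).
    by apply: DeriveDef; [exact: test_function_derivable tphi|rewrite derive1E].
  have := is_deriveM (is_derive_affine k c y) dphi.
  by rewrite /GRing.scale /= [phi y * k]mulrC.
have caff : continuous (fun y : R => k * y + c).
  move=> y; apply: cvgD; last exact: cvg_cst.
  by apply: cvgM; [exact: cvg_cst|exact: cvg_id].
rewrite /Rintegral (continuous_FTC2 st _ (F := F))//.
- apply: continuous_subspaceT => y; apply: cvgD; apply: cvgM.
  + exact: caff.
  + exact: (test_function_derive1_continuous tphi).
  + exact: cvg_cst.
  + exact: (test_function_continuous tphi).
- by apply: continuous_derivable_oo_LRcontinuous => y; case: (dF y).
- by move=> y _; rewrite derive1E; case: (dF y).
Qed.

Lemma integrable_on_itvoo f : continuous f -> mu.-integrable `]a, b[ (EFin \o f).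
Proof.
move=> cf; apply: (@integrableS _ _ _ mu `[a, b]) => //.
  exact: subset_itv_oo_cc.
apply: continuous_compact_integrable; first exact: segment_compact.
exact: continuous_subspaceT.
Qed.

(** Integrating by parts on each side of [x] leaves [phi x] and [- phi x], since both branches equal
    1 at [x]; the terms at [a] and [b] vanish with [phi]. *)
Lemma hat_weak_derivative : weak_derivative `]a, b[ u (hat_slope a b x).
Proof.
have iu := in_Lp_integrable p1 ab hat_in_Lp.
have is_ := in_Lp_integrable p1 ab hat_slope_in_Lp.
split; [exact: open_integrable_locally|exact: open_integrable_locally|].
move=> phi tphi.
have cphi := test_function_continuous tphi.
have cphi' := test_function_derive1_continuous tphi.
have iuphi : mu.-integrable `]a, b[ (EFin \o (fun y => u y * derive1 phi y)).
  apply: (@le_integrable _ _ _ mu _ (measurable_itv _) _ (EFin \o derive1 phi)) => //.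
  - apply/measurable_EFinP; apply: measurable_funM; first exact: measurable_hat.
    by apply: measurable_funTS; exact: continuous_measurable_fun.
  - move=> y; rewrite /= in_itv/= lee_fin normrM => /andP[ay yb].
    by rewrite ler_piMl// hat_norm_le1// !ltW.
  - exact: integrable_on_itvoo.
have isphi : mu.-integrable `]a, b[ (EFin \o (fun y => hat_slope a b x y * phi y)).
  exact: (integrable_jumpM _ _ _ (measurable_itv _) (integrable_on_itvoo cphi)).
pose F y := u y * derive1 phi y + hat_slope a b x y * phi y.
have iF : mu.-integrable `]a, b[ (EFin \o F).
  exact: (@integrableD _ _ _ mu _ (measurable_itv _) _ _ iuphi isphi).
suff F0 : \int[mu]_(y in `]a, b[) F y = 0.
  rewrite -[LHS]fineK; last exact: integrable_fin_num.
  rewrite -[X in (_ = - X)%E]fineK; last exact: integrable_fin_num.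
  rewrite -EFinN; congr EFin; apply/eqP; rewrite -addr_eq0; apply/eqP.
  by rewrite -[RHS]F0 RintegralD.
have [ax xb] := andP axb.
have phia : phi a = 0 by apply: test_function_eq0 tphi _; rewrite /= in_itv/= ltxx.
have phib : phi b = 0.
  by apply: test_function_eq0 tphi _; rewrite /= in_itv/= ltxx andbF.
have := Rintegral_itvB iF; move=> /(_ x); rewrite !bnd_simp => /(_ (ltW ax) xb) => /eqP.
have FL : \int[mu]_(y in `]a, x]) F y = phi x.
  rewrite Rintegral_itv_obnd_cbnd; last first.
    by apply: integrableS iF => //; apply: subset_itvl; rewrite bnd_simp.
  transitivity (\int[mu]_(y in `[a, x]) ((r1 * y + - (r1 * a)) * derive1 phi y + r1 * phi y)).
    apply: eq_Rintegral => y; rewrite inE/= in_itv/= /F => /andP[ay yx].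
    rewrite uL ?ay// /hat_slope /jump yx -/r1; congr (_ * _ + _).
    by ring.
  rewrite integral_affine_test_function// phia mulr0 subr0.
  by rewrite -mulrBr r1E mul1r.
have FR : \int[mu]_(y in `]x, b[) F y = - phi x.
  rewrite Rintegral_itv_bndo_bndc; last first.
    by apply: integrableS iF => //; apply: subset_itvr; rewrite bnd_simp ltW.
  (* At [x] itself [F] carries the left slope, so the right affine form is substituted while [x] is
     still excluded, and the endpoint is added afterwards. *)
  transitivity (\int[mu]_(y in `]x, b]) ((- r2 * y + r2 * b) * derive1 phi y + - r2 * phi y)).
    apply: eq_Rintegral => y; rewrite inE/= in_itv/= /F => /andP[xy yb].
    rewrite uR ?(ltW xy)// /hat_slope /jump leNgt xy/= -/r2; congr (_ * _ + _).
    by ring.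
  rewrite Rintegral_itv_obnd_cbnd; last first.
    apply: (@integrableS _ _ _ mu `[x, b]) => //.
      by apply: subset_itv; rewrite bnd_simp.
    apply: continuous_compact_integrable; first exact: segment_compact.
    apply: continuous_subspaceT => y; apply: cvgD; apply: cvgM;
      [|exact: cphi'|exact: cvg_cst|exact: cphi].
    apply: cvgD; last exact: cvg_cst.
    by apply: cvgM; [exact: cvg_cst|exact: cvg_id].
  rewrite integral_affine_test_function// phib mulr0 sub0r.
  by rewrite mulNr addrC -mulrBr r2E mul1r.
by rewrite FL FR subr_eq addNr => /eqP.
Qed.

(** Integrates [|f|^p <= C^p * 1_B]. It makes a bounded error on a small set small in L^p. *)
Lemma Lp_norm_le_on (B : set R) f (C m : R) : measurable B ->
  measurable_fun `]a, b[ f -> (mu B <= m%:E)%E ->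
  (forall y, a < y < b -> `|f y| <= C) ->
  (forall y, a < y < b -> ~ B y -> f y = 0) ->
  (Lp_norm p `]a, b[ f <= (C * m `^ p^-1)%:E)%E.
Proof.
move=> mB mf Bm fC fB.
have C0 : 0 <= C.
  apply: le_trans (normr_ge0 (f x)) _; exact: fC.
have m0 : 0 <= m by rewrite -lee_fin; apply: le_trans Bm.
rewrite Lp_normE ?gt_eqF//.
have : (0 <= \int[mu]_(y in `]a, b[) (`|f y| `^ p)%:E)%E.
  by apply: integral_ge0 => y _; rewrite lee_fin powR_ge0.
have : (\int[mu]_(y in `]a, b[) (`|f y| `^ p)%:E <= (C `^ p * m)%:E)%E.
  apply: (@le_trans _ _ (\int[mu]_(y in `]a, b[) ((C `^ p)%:E * (\1_B y)%:E))%E).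
    apply: ge0_le_integral => //.
    - apply/measurable_EFinP; apply: (measurableT_comp (measurable_powR p)).
      exact: measurableT_comp.
    - apply/measurable_EFinP; apply: measurable_funM => //.
    - move=> y; rewrite /= in_itv/= => yab; rewrite -EFinM lee_fin indicE.
      have [yB|yB] := boolP (y \in B).
        by rewrite mulr1 ge0_ler_powR ?nnegrE ?(ltW p0) ?fC.
      rewrite (fB _ yab); first by rewrite normr0 powR0 ?gt_eqF// mulr0.
      by move/mem_set; rewrite (negbTE yB).
  rewrite ge0_integralZl//; last 2 first.
  - by apply/measurable_EFinP; exact: measurable_indic.
  - by rewrite lee_fin powR_ge0.
  rewrite integral_indic// EFinM lee_wpmul2l ?lee_fin ?powR_ge0//.
  by apply: le_trans Bm; apply: le_measure; rewrite ?inE//; exact: measurableI.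
case: (integral _ _ _) => [I||]//; rewrite !lee_fin => Im I0.
have pi0 : 0 <= p^-1 by rewrite invr_ge0 ltW.
apply: (@le_trans _ _ ((C `^ p * m) `^ p^-1)).
  by rewrite ge0_ler_powR// ?nnegrE// mulr_ge0 ?powR_ge0.
by rewrite powRM ?powR_ge0// -powRrM divff ?gt_eqF// powRr1.
Qed.

(** The two branches are blended by a ramp just after [x], and the result is cut off near [a] and
    [b] by two more ramps. The conditions on [e] keep the three transition zones disjoint; [C] does
    not depend on [e]. *)
Lemma hat_approx : exists2 C, 0 < C & forall e, 0 < e -> 4 * e <= x - a -> 4 * e <= b - x ->
  exists2 phi, test_function `]a, b[ phi &
  (Lp_norm p `]a, b[ (u \- phi)%R <= (C * (5 * e) `^ p^-1)%:E)%E /\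
  (Lp_norm p `]a, b[ (hat_slope a b x \- derive1 phi)%R <= (C * (5 * e) `^ p^-1)%:E)%E.
Proof.
have [ax xb] := andP axb.
have [M M0 ramp] := @ramp_ex R.
(* The terms bound, in order, [|u|], [|phi|], and the slope error, which is at most
   [(r1 + r2) * (2 + 3 * M)]. *)
pose C := 1 + (r1 + r2) * (b - a) + (r1 + r2) * (3 + 3 * M).
have r120 : 0 < r1 + r2 by rewrite addr_gt0.
have C0 : 0 < C.
  by rewrite /C ltr_wpDr ?ltr_wpDr ?mulr_ge0 ?(ltW r120)//; lra.
exists C => // e e0 ea eb.
(* Starting at [a + e] and ending the last cutoff at [b - e] keeps the support of [phi] inside
   [[a + e, b - e]], a compact subset of the open interval. *)
have [rho1 [d1 h1]] := ramp (a + e) e e0.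
have [rho2 [d2 h2]] := ramp (b - 2 * e) e e0.
have [rho3 [d3 h3]] := ramp x e e0.
pose L1 y := r1 * y + - (r1 * a).
pose L2 y := - r2 * y + r2 * b.
pose T y := L1 y + (L2 y - L1 y) * rho3 y.
pose phi y := rho1 y * (1 - rho2 y) * T y.
pose dT y := r1 - (r1 + r2) * rho3 y + (L2 y - L1 y) * d3 y.
(* [d1 T], [d2 T] and [(L2 - L1) d3] stay bounded as [e] tends to 0: the slopes
   are O(1/e), but [T] is O(e) where [d1] or [d2] does not vanish, and
   [L2 - L1] is O(e) where [d3] does not vanish. *)
pose dphi y := (d1 y * T y) * (1 - rho2 y) - rho1 y * (d2 y * T y) +
  rho1 y * (1 - rho2 y) * dT y.
have L21 n : diffn n (fun y => L2 y - L1 y) by apply: diffnB; exact: diffn_affine_id.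
have phi_smooth n : diffn n phi.
  apply: (diffnM (diffnM (ramp_diffn h1 n) (diffnB (diffn_cst n 1) (ramp_diffn h2 n)))).
  apply: diffnD; first exact: diffn_affine_id.
  exact: diffnM (L21 n) (ramp_diffn h3 n).
have phi_derive y : is_derive y (1:R) phi (dphi y).
  have dL1 := is_derive_affine r1 (- (r1 * a)) y.
  have dL2 := is_derive_affine (- r2) (r2 * b) y.
  have dTy := is_deriveD dL1 (is_deriveM (is_deriveB dL2 dL1) (is_derive_ramp h3 y)).
  have d12 := is_deriveM (is_derive_ramp h1 y)
    (is_deriveB (is_derive_cst (1:R) y (1:R)) (is_derive_ramp h2 y)).
  apply: is_derive_eq (is_deriveM d12 dTy) _.
  rewrite /GRing.scale /= /dphi /dT /T /L1 /L2 !fctE.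
  by ring.
have phi'E : derive1 phi = dphi.
  by apply/funext => y; rewrite derive1E; case: (phi_derive y).
(* These sets contain every point where [phi] or its slope can differ from the hat. [B1] and [B3]
   reach the endpoints because [phi] vanishes there on a strip of width [e]; the lengths [2e], [e],
   [2e] add up to [5e]. *)
pose B1 := `[a, a + 2 * e]%classic : set R.
pose B2 := `[x, x + e]%classic : set R.
pose B3 := `[b - 2 * e, b]%classic : set R.
pose B := B1 `|` B2 `|` B3.
have mB1 : measurable B1 by exact: measurable_itv.
have mB2 : measurable B2 by exact: measurable_itv.
have mB3 : measurable B3 by exact: measurable_itv.
have mB : measurable B by do 2?apply: measurableU.
have muB : (mu B <= (5 * e)%:E)%E.
  have mui (s t : R) : s < t -> mu `[s, t]%classic = (t - s)%:E.
    by move=> st; rewrite lebesgue_measure_itv/= lte_fin st -EFinB.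
  apply: (@le_trans _ _ (mu B1 + mu B2 + mu B3)%E).
    apply: le_trans (measureU2 mu _ _) _ => //; first exact: measurableU.
    by apply: leeD => //; exact: measureU2.
  rewrite !mui; [|lra..].
  by rewrite -!EFinD lee_fin; lra.
have tphi : test_function `]a, b[ phi.
  have supp : closure [set y | phi y != 0] `<=` `[a + e, b - e].
    have /closure_id -> : closed (`[a + e, b - e]%classic : set R) by exact: itv_closed.
    apply: closureS => y /= phiy; rewrite in_itv/=; apply/andP; split.
      rewrite leNgt; apply: contraNN phiy => /ltW ya.
      by rewrite /phi (ramp_eq0 h1 ya) !mul0r.
    rewrite leNgt; apply: contraNN phiy => yb.
    by rewrite /phi (ramp_eq1 h2) ?subrr ?mulr0 ?mul0r//; lra.
  split.
  - exact: diffnP.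
  - apply: subclosed_compact supp; first exact: closed_closure.
    exact: segment_compact.
  - apply: subset_trans supp _ => y /=; rewrite !in_itv/= => /andP[? ?].
    by apply/andP; split; lra.
have cphi := test_function_continuous tphi.
have cphi' := test_function_derive1_continuous tphi.
have d1_eq0 y : a + 2 * e < y -> d1 y = 0.
  move=> ya; apply/eqP; apply: contraTT ya => /(ramp_slope_neq0 h1) /andP[? ?].
  by rewrite -leNgt; lra.
have d2_eq0 y : y < b - 2 * e -> d2 y = 0.
  move=> ya; apply/eqP; apply: contraTT ya => /(ramp_slope_neq0 h2) /andP[? ?].
  by rewrite -leNgt; lra.
have d3_eq0 y : (y < x) || (x + e < y) -> d3 y = 0.
  move=> ya; apply/eqP; apply: contraTT ya => /(ramp_slope_neq0 h3) /andP[? ?].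
  by rewrite negb_or -!leNgt; apply/andP; split; lra.
have L1E y : L1 y = r1 * (y - a) by rewrite /L1; ring.
have L2E y : L2 y = r2 * (b - y) by rewrite /L2; ring.
have offB y : a < y < b -> ~ B y -> phi y = u y /\ dphi y = hat_slope a b x y.
  move=> /andP[ay yb] yB.
  have ya : a + 2 * e < y.
    rewrite ltNge; apply/negP => ya; apply: yB; left; left; rewrite /B1/= in_itv/=.
    by rewrite (ltW ay).
  have yb' : y < b - 2 * e.
    rewrite ltNge; apply/negP => yb'; apply: yB; right; rewrite /B3/= in_itv/=.
    by rewrite yb' ltW.
  have xyx : (y < x) || (x + e < y).
    apply: contra_notT yB; rewrite negb_or -!leNgt => /andP[xy yx].
    by left; right; rewrite /B2/= in_itv/= xy.
  rewrite /dphi /phi /dT /T d1_eq0// d2_eq0// d3_eq0//.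
  rewrite (ramp_eq1 h1 (y := y)); last by lra.
  rewrite (ramp_eq0 h2 (y := y)); last by lra.
  rewrite L1E L2E /hat_slope /jump -/r1 -/r2.
  case/orP : xyx => xy.
    rewrite (ramp_eq0 h3 (ltW xy)) (ltW xy) uL ?ltW//.
    by split; rewrite -/r1; ring.
  rewrite (ramp_eq1 h3 (ltW xy)) leNgt ifF; last by apply/negbTE; rewrite negbK; lra.
  rewrite uR; last by apply/andP; split; lra.
  by split; rewrite -/r2; ring.
have phi_le y : a < y < b -> `|u y - phi y| <= C.
  move=> /andP[ay yb].
  have uy : `|u y| <= 1 by rewrite hat_norm_le1// !ltW.
  have [? ?] := andP (ramp_itv01 h1 y).
  have [? ?] := andP (ramp_itv01 h2 y).
  have [? ?] := andP (ramp_itv01 h3 y).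
  (* [T] is a convex combination of the two branches, hence bounded by their bounds. *)
  have TE : T y = L1 y * (1 - rho3 y) + L2 y * rho3 y by rewrite /T; ring.
  have L1y : 0 <= L1 y <= r1 * (b - a).
    by rewrite L1E pmulr_rge0// ler_pM2l// lerD2r subr_ge0 !ltW.
  have L2y : 0 <= L2 y <= r2 * (b - a).
    by rewrite L2E pmulr_rge0// ler_pM2l// lerD2l lerN2 subr_ge0 !ltW.
  have [[? ?] [? ?]] := (andP L1y, andP L2y).
  have Ty : `|T y| <= (r1 + r2) * (b - a).
    rewrite TE ger0_norm; last by rewrite addr_ge0// mulr_ge0// subr_ge0.
    have ? : L1 y * (1 - rho3 y) <= L1 y by rewrite ler_piMr//; lra.
    have ? : L2 y * rho3 y <= L2 y by rewrite ler_piMr.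
    by rewrite [leRHS]mulrDl; lra.
  have phiy : `|phi y| <= `|T y|.
    rewrite /phi normrM ler_piMl// ger0_norm ?mulr_ge0 ?subr_ge0//.
    by rewrite mulr_ile1 ?subr_ge0//; lra.
  apply: le_trans (ler_normB _ _) _.
  by rewrite /C -addrA lerD// ler_wpDr ?(le_trans phiy)// mulr_ge0 ?ltW//; lra.
have dphi_le y : a < y < b -> `|hat_slope a b x y - dphi y| <= C.
  move=> /andP[ay yb].
  have sy : `|hat_slope a b x y| <= r1 + r2.
    rewrite /hat_slope /jump; case: ifP => _; last rewrite normrN.
      by rewrite ger0_norm ?(ltW r1_gt0)// lerDl ltW.
    by rewrite ger0_norm ?(ltW r2_gt0)// lerDr ltW.
  have [? ?] := andP (ramp_itv01 h1 y).
  have [? ?] := andP (ramp_itv01 h2 y).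
  have [? ?] := andP (ramp_itv01 h3 y).
  have slope_le (d v r : R) : `|d| <= M / e -> `|v| <= r * e -> `|d * v| <= r * M.
    move=> dM vr; rewrite normrM; apply: le_trans (ler_pM _ _ dM vr) _ => //.
    by rewrite mulrCA divfK// gt_eqF.
  have dT1 : `|d1 y * T y| <= 2 * r1 * M.
    have [->|d1y] := eqVneq (d1 y) 0.
      by rewrite mul0r normr0 !mulr_ge0 ?ltW.
    have /andP[? ?] := ramp_slope_neq0 h1 d1y.
    apply: slope_le; first exact: (ramp_slope_le h1).
    (* Where [d1] is nonzero, [y <= a + 2 * e <= x], so [T] is the left branch and is at most
       [2 * r1 * e]. *)
    rewrite /T (ramp_eq0 h3) ?mulr0 ?addr0 ?L1E; last by lra.
    rewrite ger0_norm ?mulr_ge0 ?(ltW r1_gt0)//; last by lra.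
    by rewrite mulrAC [leRHS]mulrC ler_pM2l//; lra.
  have dT2 : `|d2 y * T y| <= 2 * r2 * M.
    have [->|d2y] := eqVneq (d2 y) 0.
      by rewrite mul0r normr0 !mulr_ge0 ?ltW.
    have /andP[? ?] := ramp_slope_neq0 h2 d2y.
    apply: slope_le; first exact: (ramp_slope_le h2).
    (* Symmetrically, [y >= b - 2 * e >= x + e] here, so [T] is the right branch and is at most
       [2 * r2 * e]. *)
    rewrite /T (ramp_eq1 h3) ?mulr1 ?subrKC ?L2E; last by lra.
    rewrite ger0_norm ?mulr_ge0 ?(ltW r2_gt0)//; last by lra.
    by rewrite mulrAC [leRHS]mulrC ler_pM2l//; lra.
  have dT3 : `|(L2 y - L1 y) * d3 y| <= (r1 + r2) * M.
    have [->|d3y] := eqVneq (d3 y) 0.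
      by rewrite mulr0 normr0 mulr_ge0 ?ltW.
    have /andP[? ?] := ramp_slope_neq0 h3 d3y.
    rewrite mulrC; apply: slope_le; first exact: (ramp_slope_le h3).
    (* The branches cross at [x], so their difference is linear in [y - x], which is at most [e]
       where [d3] is nonzero. *)
    have -> : L2 y - L1 y = - ((r1 + r2) * (y - x)).
      rewrite L1E L2E; transitivity (r2 * (b - x) - r1 * (x - a) - (r1 + r2) * (y - x)).
        by ring.
      by rewrite r1E r2E subrr sub0r.
    rewrite normrN ger0_norm ?mulr_ge0 ?(ltW r120)//; last by lra.
    by rewrite ler_pM2l//; lra.
  have dTy : `|dT y| <= (r1 + r2) * (1 + M).
    rewrite /dT mulrDr mulr1; apply: le_trans (ler_normD _ _) _.
    apply: lerD => //; rewrite ler_norml; apply/andP; split.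
      have : (r1 + r2) * rho3 y <= r1 + r2 by rewrite ler_piMr// ltW.
      by move: r1_gt0 r2_gt0; lra.
    have : 0 <= (r1 + r2) * rho3 y by rewrite mulr_ge0// ltW.
    by move: r1_gt0 r2_gt0; lra.
  have le1 (s v : R) : 0 <= s <= 1 -> `|s * v| <= `|v|.
    by move=> /andP[s0 s1]; rewrite normrM ler_piMl// ger0_norm.
  have dphiy : `|dphi y| <= `|d1 y * T y| + `|d2 y * T y| + `|dT y|.
    rewrite /dphi; apply: le_trans (ler_normD _ _) _; apply: lerD.
      apply: le_trans (ler_normB _ _) _; apply: lerD; last by apply: le1; apply/andP.
      by rewrite mulrC; apply: le1; apply/andP; split; lra.
    apply: le1; rewrite mulr_ge0 ?mulr_ile1 ?subr_ge0//; lra.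
  apply: le_trans (ler_normB _ _) _.
  have : 0 <= (r1 + r2) * (b - a) by rewrite mulr_ge0// ltW//; lra.
  rewrite /C !mulrDr !mulrDl in dTy *.
  lra.
exists phi => //; split; apply: (@Lp_norm_le_on B) => //.
- apply: measurable_funB; first exact: measurable_hat.
  by apply: measurable_funTS; exact: continuous_measurable_fun.
- by move=> y yab yB; have [phiy _] := offB y yab yB; rewrite /= phiy subrr.
- apply: measurable_funB; first exact: measurable_jump.
  by apply: measurable_funTS; exact: continuous_measurable_fun.
- by move=> y; rewrite phi'E; exact: dphi_le.
- by move=> y yab yB; have [_ phiy] := offB y yab yB; rewrite /= phi'E phiy subrr.
Qed.

Lemma hat_W01p : sobolev_W01p p `]a, b[ u (hat_slope a b x).
Proof.
split.
- by rewrite closure_itvoo//; exact: hat_within_continuous.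
- by split; [exact: hat_in_Lp|exact: hat_slope_in_Lp|exact: hat_weak_derivative].
move=> eps eps0; have [C C0 approx] := hat_approx.
(* With [5 * e <= d] each of the two norms is at most [C * d^(1/p) = eps / 4], so their sum stays
   strictly below [eps]. *)
pose d := (eps / (4 * C)) `^ p.
have d0 : 0 < d by rewrite powR_gt0// divr_gt0// mulr_gt0.
pose e := Order.min (d / 5) (Order.min ((x - a) / 4) ((b - x) / 4)).
have e0 : 0 < e by rewrite !lt_min !divr_gt0.
have [ed ea eb] : [/\ e <= d / 5, e <= (x - a) / 4 & e <= (b - x) / 4].
  by rewrite /e !ge_min !lexx !orbT.
have [||phi tphi [n1 n2]] := approx e e0; [lra|lra|].
exists phi => //; apply: le_lt_trans (leeD n1 n2) _.
rewrite -EFinD lte_fin.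
have : (5 * e) `^ p^-1 <= eps / (4 * C).
  have -> : eps / (4 * C) = d `^ p^-1.
    rewrite -powRrM divff ?gt_eqF// powRr1// ltW// divr_gt0// mulr_gt0//.
  by rewrite ge0_ler_powR ?nnegrE ?invr_ge0 ?(ltW p0) ?(ltW d0)//; lra.
rewrite ler_pdivlMr; last by rewrite mulr_gt0.
nra.
Qed.

End hat_W01p.

Unset Implicit Arguments.

Theorem corollary2p8 (R : realType) (p a b : R) (hp : 1 < p) (hab : a < b)
    (x : R) (hx : a < x < b) :
  s_ p `]a, b[ x =
    (((x - a) `^ (1 - p) + (b - x) `^ (1 - p)) `^ (- p^-1))%:E
  /\
  (forall u : R -> R,
    weak_p_laplace_dirac p `]a, b[ (fine (s_ p `]a, b[ x) `^ (- p)) x u <->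
    (forall y : R, a <= y <= x -> u y = (y - a) * (x - a)^-1) /\
    (forall y : R, x <= y <= b -> u y = (b - y) * (b - x)^-1)).
Proof.
pose w y := if y <= x then (y - a) * (x - a)^-1 else (b - y) * (b - x)^-1.
have xa : 0 < x - a by case/andP: hx; lra.
have bx : 0 < b - x by case/andP: hx; lra.
have wL y : a <= y <= x -> w y = (y - a) * (x - a)^-1.
  by rewrite /w => /andP[_ ->].
have wR y : x <= y <= b -> w y = (b - y) * (b - x)^-1.
  rewrite /w le_eqVlt => /andP[/predU1P[<- _|xy _]]; last by rewrite leNgt xy.
  by rewrite lexx !divff ?gt_eqF.
have wx : w x = 1 by rewrite /w lexx divff// gt_eqF.
have wW := hat_W01p hp hx wL wR.
have sE := s_hatE hp hx wW wx.
split=> [|u]; first exact: sE.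
(* By the first part, [s_p(x)^(-p) = (c^(-1/p))^(-p) = c], the strength of the source that the hat
   solves for. *)
have -> : fine (s_ p `]a, b[ x) `^ (- p) = hat_weight p a b x.
  rewrite sE /= -powRrM mulrNN mulVf ?gt_eqF ?(lt_trans _ hp)//.
  by rewrite powRr1// ltW// hat_weight_gt0.
split=> [/(weak_solution_hat hp hx wW wx) uw|[uL uR]].
  split=> y /andP[y1 y2].
    by rewrite uw ?wL ?y1//; apply/andP; split; lra.
  by rewrite uw ?wR ?y1//; apply/andP; split; lra.
(* [hat_W01p] asks for the hat formula only on [[a, b]], so it applies to [u] directly, whatever its
   values elsewhere. *)
exists (hat_slope a b x); first exact: hat_W01p.
by move=> phi h phiW; exact: integral_flux_hat_slope.
Qed.
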